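(* Consider the KOCA algorithm with cluster radius $k \ge 1$ and cluster head probability $p$ run on a stationary wireless sensor network with error-free and contention-free communication. At the end of the KOCA algorithm, every node is either a cluster head, or a non-cluster-head node that belongs to one or more clusters.
   Context: The network is a finite undirected graph $G=(V,E)$; vertices are sensor nodes with unique IDs and edges are bidirectional wireless links. Communication is error-free and contention-free. Let $t(k)$ be the time needed for a message to travel $k$ hops, let $\delta$ be a constant bounding the time any node needs to finish bootstrapping and start the clustering process, and let $c$ be a constant. KOCA ($k$-hop Overlapping Clustering Algorithm) is the following distributed randomized algorithm. (1) Initialization. Each node independently becomes a cluster head (CH) with probability $p$; otherwise its status is non-cluster-head (NCH). A CH broadcasts an advertisement CH_AD carrying its own ID and hop count $1$, and sets a timer JREQ_WAIT of length $c\,t(k)+\delta$. An NCH node sets a timer CH_AD_WAIT of length $t(k)+\delta$. (2) Advertisement flooding. Each node keeps a table CH_table of known cluster heads with entries (cluster head ID, hop count, previous neighbor on the path). On first receiving a CH_AD of a given cluster head (other than itself), a node adds an entry to CH_table and, if the hop count is less than $k$, rebroadcasts the message with hop count increased by one. So advertisements propagate at most $k$ hops. (3) When CH_AD_WAIT fires at an NCH node: if its CH_table is empty, it changes its status to CH, broadcasts its own CH_AD with hop count $1$ and sets JREQ_WAIT; otherwise, for every cluster head in its CH_table it sends a join request (JREQ), which is forwarded back to that cluster head along the ''previous neighbor'' pointers, and the node thereby joins the cluster of each such cluster head. (4) When JREQ_WAIT fires at a CH node, that node terminates the clustering phase. A non-cluster-head node belongs to the cluster of a cluster head $u$ if it has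 joined it in step (3), i.e. it received an advertisement of $u$ (so it is within $k$ hops of $u$) and sent a join request to $u$. A node may belong to several clusters. *)

(* Defs.v *)
From mathcomp Require Import all_boot all_order all_algebra.
From mathcomp Require Import all_classical all_reals all_analysis.

Set Implicit Arguments.
Unset Strict Implicit.
Unset Printing Implicit Defensive.

Import Order.TTheory GRing.Theory Num.Theory.
Local Open Scope classical_set_scope.
Local Open Scope ring_scope.

(** Mutually independent Bernoulli([p]) coins, one per vertex.  Taking for [A]
    a singleton gives [P (coin v = true) = p]; the general case is then the
    product rule over every subfamily of the events [coin v = true]. *)
Definition independent_coins d (T : measurableType d) (R : realType)
    (P : probability T R) (V : finType) (p : R) (coin : V -> T -> bool) : Prop :=
  (forall v, measurable [set w | coin v w]) /\
  (forall A : {set V},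
     P [set w | forall v, v \in A -> coin v w] = (p ^+ #|A|)%:E).

(** [Idle] is the status of a node that has not finished bootstrapping. *)
Inductive status := Idle | CH | NCH.

(** [CH_AD u h]: advertisement of the cluster head [u], with hop count [h].
    [JREQ s u h]: join request of [s] to the cluster head [u], on its [h]-th
    hop; [h] is only used to determine the latency of that hop. *)
Inductive message (V : Type) :=
  | CH_AD of V & nat
  | JREQ of V & V & nat.

(** A message on the link from [sender] to [receiver], to be received at the
    latest at time [due]. *)
Record packet (R V : Type) := Packet {
  sender : V;
  receiver : V;
  payload : message V;
  due : R }.

Record entry (V : Type) := Entry {
  head_id : V;
  hop_count : nat;
  prev_neighbor : V }.

(** The timers hold their expiry date, and [None] when they are not running.
    [jreq_sent] lists the cluster heads to which the node has sent a join
    request of its own. *)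
Record node (R V : Type) := Node {
  node_status : status;
  ch_table : seq (entry V);
  ch_ad_wait : option R;
  jreq_wait : option R;
  jreq_sent : seq V;
  terminated : bool }.

(** Global configuration: date, states of the nodes, packets in transit. *)
Record config (R V : Type) := Config {
  now : R;
  state : V -> node R V;
  transit : seq (packet R V) }.

Section Koca.
Context (R : realType) (V : finType).
Variables (e : rel V) (k : nat) (t : nat -> R) (delta c : R) (coin : V -> bool).

Implicit Types (s : node R V) (u v w : V) (cf : config R V).

Definition idle_node : node R V := Node Idle [::] None None [::] false.

Definition initial : config R V := Config 0 (fun=> idle_node) [::].

(** Since [t h] bounds the time a message needs for [h] hops, its [h]-th hop
    takes at most [t h - t h.-1]. *)
Definition hop_time (h : nat) : R := t h - t h.-1.

Definition unicast (x : R) v w (h : nat) (m : message V) : packet R V :=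
  Packet v w m (x + hop_time h).

Definition broadcast_ad (x : R) v u (h : nat) : seq (packet R V) :=
  [seq unicast x v w h (CH_AD u h) | w <- enum V & e v w].

Definition known u s : bool := u \in [seq head_id i | i <- ch_table s].

(** Each of the handlers below maps the date, the node and its state to the new
    state of the node and the packets that it sends. *)

Definition become_head (x : R) v s : node R V * seq (packet R V) :=
  (Node CH (ch_table s) None (Some (x + (c * t k + delta)))
        (jreq_sent s) (terminated s),
   broadcast_ad x v v 1).

Definition on_start (x : R) v s : node R V * seq (packet R V) :=
  if coin v then become_head x v s
  else (Node NCH (ch_table s) (Some (x + (t k + delta))) None
             (jreq_sent s) (terminated s), [::]).

Definition on_ch_ad_wait (x : R) v s : node R V * seq (packet R V) :=
  if ch_table s is [::] then become_head x v s
  else (Node (node_status s) (ch_table s) None (jreq_wait s)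
             [seq head_id i | i <- ch_table s] (terminated s),
        [seq unicast x v (prev_neighbor i) 1 (JREQ v (head_id i) 1)
           | i <- ch_table s]).

Definition on_jreq_wait s : node R V :=
  Node (node_status s) (ch_table s) (ch_ad_wait s) None (jreq_sent s) true.

Definition on_ch_ad (x : R) v s (from u : V) (h : nat) :
    node R V * seq (packet R V) :=
  if (u == v) || known u s then (s, [::])
  else (Node (node_status s) (rcons (ch_table s) (Entry u h from))
             (ch_ad_wait s) (jreq_wait s) (jreq_sent s) (terminated s),
        if (h < k)%N then broadcast_ad x v u h.+1 else [::]).

Definition on_jreq (x : R) v s (src u : V) (h : nat) :
    node R V * seq (packet R V) :=
  (s, if u == v then [::]
      else [seq unicast x v (prev_neighbor i) h.+1 (JREQ src u h.+1)
              | i <- ch_table s & head_id i == u]).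

(** A node that has terminated the clustering phase ignores its messages. *)
Definition on_receive (x : R) v s (pk : packet R V) :
    node R V * seq (packet R V) :=
  if terminated s then (s, [::]) else
  match payload pk with
  | CH_AD u h => on_ch_ad x v s (sender pk) u h
  | JREQ src u h => on_jreq x v s src u h
  end.

Definition commit cf v (r : node R V * seq (packet R V))
    (rest : seq (packet R V)) : config R V :=
  Config (now cf) [eta state cf with v |-> r.1] (rest ++ r.2).

Definition not_expired (x : R) (timer : option R) : Prop :=
  if timer is Some d then x <= d else True.

(** Time may pass until date [x] only if nothing has to happen before: every
    node starts by date [delta], timers fire on expiry, and packets are received
    by their due date, except that those reaching a node which is still
    bootstrapping are held until it starts. *)
Definition can_wait_until (x : R) cf : Prop :=
  (forall v, node_status (state cf v) = Idle -> x <= delta) /\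
  (forall v, not_expired x (ch_ad_wait (state cf v))) /\
  (forall v, not_expired x (jreq_wait (state cf v))) /\
  (forall l1 pk l2, transit cf = l1 ++ pk :: l2 ->
     node_status (state cf (receiver pk)) <> Idle -> x <= due pk).

Inductive step cf : config R V -> Prop :=
  | Step_start v :
      node_status (state cf v) = Idle ->
      step cf (commit cf v (on_start (now cf) v (state cf v)) (transit cf))
  | Step_receive l1 pk l2 :
      transit cf = l1 ++ pk :: l2 ->
      node_status (state cf (receiver pk)) <> Idle ->
      step cf (commit cf (receiver pk)
                 (on_receive (now cf) (receiver pk) (state cf (receiver pk)) pk)
                 (l1 ++ l2))
  | Step_ch_ad_wait v x :
      ch_ad_wait (state cf v) = Some x -> x <= now cf ->
      step cf (commit cf v (on_ch_ad_wait (now cf) v (state cf v)) (transit cf))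
  | Step_jreq_wait v x :
      jreq_wait (state cf v) = Some x -> x <= now cf ->
      step cf (commit cf v (on_jreq_wait (state cf v), [::]) (transit cf))
  | Step_wait x :
      now cf <= x -> can_wait_until x cf ->
      step cf (Config x (state cf) (transit cf)).

Inductive reachable : config R V -> Prop :=
  | Reach_initial : reachable initial
  | Reach_step cf cf' : reachable cf -> step cf cf' -> reachable cf'.

(** The algorithm is over once every node has started and all its timers have
    fired; some packets may still be in transit. *)
Definition ended cf : Prop :=
  forall v, [/\ node_status (state cf v) <> Idle,
                ch_ad_wait (state cf v) = None &
                jreq_wait (state cf v) = None].

Definition is_head cf v : Prop := node_status (state cf v) = CH.

Definition is_non_head cf v : Prop := node_status (state cf v) = NCH.

(** [v] received an advertisement of the cluster head [u] and sent it a join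
    request. *)
Definition belongs cf v u : Prop :=
  [/\ is_head cf u, known u (state cf v) & u \in jreq_sent (state cf v)].

End Koca.

(* Main.v *)
(** Two facts hold in every reachable configuration.  First, only cluster heads
    are ever advertised, since a node advertises itself exactly when it becomes a
    head and heads keep that status; so all tables list heads only.  Second, a
    non-head whose advertisement timer has fired had a nonempty table at that
    moment (else it would have become a head) and sent a join request to each
    head listed there. *)

Require Import Defs.
From mathcomp Require Import all_boot all_order all_algebra.
From mathcomp Require Import all_classical all_reals all_analysis.

Set Implicit Arguments.
Unset Strict Implicit.
Unset Printing Implicit Defensive.

Local Open Scope ring_scope.

Section Invariant.
Context (R : realType) (V : finType).
Variables (e : rel V) (k : nat) (t : nat -> R) (delta c : R) (coin : V -> bool).

Implicit Types (s : node R V) (u v w : V) (cf : config R V) (H : pred V).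

Definition headb s : bool := if node_status s is CH then true else false.

Definition heads cf : pred V := fun u => headb (state cf u).

Definition advertises_in H (pk : packet R V) : bool :=
  if payload pk is CH_AD u _ then H u else true.

(** The head set is a parameter rather than read off a configuration, so that a step that enlarges
    it keeps every untouched node sound by monotonicity. *)
Definition sound_node H s : Prop :=
  [/\ all (fun i => H (head_id i)) (ch_table s),
      all (fun u => known u s) (jreq_sent s) &
      node_status s = NCH -> ch_ad_wait s = None -> jreq_sent s <> [::]].

Definition sound_config cf : Prop :=
  all (advertises_in (heads cf)) (transit cf) /\
  forall v, sound_node (heads cf) (state cf v).

Lemma headbP s : reflect (node_status s = CH) (headb s).
Proof. by rewrite /headb; case: (node_status s); constructor. Qed.

Lemma sub_advertises_in H H' :
  subpred H H' -> subpred (advertises_in H) (advertises_in H').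
Proof. by move=> HH' pk; rewrite /advertises_in; case: (payload pk) => // u _ /HH'. Qed.

Lemma sub_sound_node H H' s : subpred H H' -> sound_node H s -> sound_node H' s.
Proof. by move=> HH' [tabH *]; split=> //; apply: sub_all tabH => i /HH'. Qed.

Lemma advertises_in_broadcast_ad H x v u h :
  H u -> all (advertises_in H) (broadcast_ad e t x v u h).
Proof. by move=> Hu; rewrite all_map; apply/allP. Qed.

(** Since [v] is not demoted, the head set only grows, so old packets and other nodes stay sound.
    The packets in [r.2] are checked against the old heads together with [v], because a new head
    advertises itself in the very step that promotes it. *)
Lemma sound_commit cf v (r : node R V * seq (packet R V)) rest :
    sound_config cf ->
    all (advertises_in (heads cf)) rest ->
    (headb (state cf v) -> headb r.1) ->
    sound_node (heads cf) r.1 ->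
    all (advertises_in [pred u | heads cf u || (u == v) && headb r.1]) r.2 ->
  sound_config (commit cf v r rest).
Proof.
move=> [_ nodes] restH keep_head newH sentH.
have sub : subpred (heads cf) (heads (commit cf v r rest)).
  by move=> u; rewrite /heads /=; case: eqP => // ->.
split=> [|u].
  rewrite all_cat (sub_all (sub_advertises_in sub) restH) /=.
  apply: sub_all sentH; apply: sub_advertises_in => u /= /orP[/sub //|].
  by case/andP=> /eqP-> hd; rewrite /heads /= eqxx.
by apply: sub_sound_node sub _ => /=; case: eqP.
Qed.

Lemma sound_become_head cf v :
  sound_config cf ->
  sound_config
    (commit cf v (become_head e k t delta c (now cf) v (state cf v)) (transit cf)).
Proof.
move=> cfH; have [transitH /(_ v) [tabH sentH _]] := cfH.
apply: sound_commit => //.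
by apply: advertises_in_broadcast_ad; rewrite /= eqxx orbT.
Qed.

Lemma sound_on_start cf v :
  sound_config cf -> node_status (state cf v) = Idle ->
  sound_config
    (commit cf v (on_start e k t delta c coin (now cf) v (state cf v))
       (transit cf)).
Proof.
move=> cfH idle; rewrite /on_start; case: ifP => _; first exact: sound_become_head.
have [transitH /(_ v) [tabH sentH _]] := cfH.
(* An [Idle] node is no head, so turning it into [NCH] demotes nobody; its [ch_ad_wait] timer now
   runs, which makes the last clause of [sound_node] vacuous. *)
by apply: sound_commit => //; rewrite /headb idle.
Qed.

Lemma sound_on_ch_ad_wait cf v :
  sound_config cf ->
  sound_config
    (commit cf v (on_ch_ad_wait e k t delta c (now cf) v (state cf v))
       (transit cf)).
Proof.
move=> cfH; rewrite /on_ch_ad_wait.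
case tabE: (ch_table _) => [|i l]; first exact: sound_become_head.
have [transitH /(_ v) [tabH _ _]] := cfH; rewrite tabE in tabH.
(* The new [jreq_sent] lists exactly the heads of a nonempty table, hence is nonempty and known. *)
by apply: sound_commit => //; rewrite all_map; apply: sub_all (all_predT _).
Qed.

Lemma sound_on_jreq_wait cf v :
  sound_config cf ->
  sound_config (commit cf v (on_jreq_wait (state cf v), [::]) (transit cf)).
Proof. by move=> cfH; have [transitH /(_ v) ?] := cfH; apply: sound_commit. Qed.

(** A new table entry names the head advertised by a packet in transit, and a rebroadcast repeats
    that head, so soundness passes from [transit] to the tables and back. *)
Lemma sound_on_receive cf l1 pk l2 :
  sound_config cf -> transit cf = l1 ++ pk :: l2 ->
  sound_config
    (commit cf (receiver pk)
       (on_receive e k t (now cf) (receiver pk) (state cf (receiver pk)) pk)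
       (l1 ++ l2)).
Proof.
move=> cfH transitE; have [+ /(_ (receiver pk)) vH] := cfH.
rewrite transitE all_cat /= => /and3P[l1H pkH l2H].
have restH : all (advertises_in (heads cf)) (l1 ++ l2) by rewrite all_cat l1H.
rewrite /on_receive; case: ifP => _; first exact: sound_commit.
move: pkH; rewrite /advertises_in.
case: (payload pk) => [u h uH | src u h _]; last first.
  apply: sound_commit => //=; case: ifP => // _.
  by rewrite all_map; apply: sub_all (all_predT _).
rewrite /on_ch_ad; case: ifP => _; first exact: sound_commit.
have [tabH sentH joined] := vH.
apply: sound_commit => //=; last first.
  by case: ifP => // _; apply: advertises_in_broadcast_ad; rewrite /= uH.
split=> //=; first by rewrite all_rcons uH.
by apply: sub_all sentH => a; rewrite /known map_rcons mem_rcons inE => ->; rewrite orbT.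
Qed.

Lemma sound_reachable cf :
  reachable e k t delta c coin cf -> sound_config cf.
Proof.
elim=> [|{}cf cf' _ cfH]; first by [].
case=> [v idle | l1 pk l2 transitE _ | v x _ _ | v x _ _ | x _ _].
- exact: sound_on_start.
- exact: sound_on_receive.
- exact: sound_on_ch_ad_wait.
- exact: sound_on_jreq_wait.
(* Waiting changes only the date, which [sound_config] does not inspect. *)
- exact: cfH.
Qed.

End Invariant.

Theorem lemmaA2 (R : realType) (V : finType) (e : rel V)
    (e_sym : symmetric e) (e_irr : irreflexive e)
    (k : nat) (k_ge1 : (1 <= k)%N)
    (t : nat -> R) (delta c p : R)
    (d : measure_display) (T : measurableType d) (P : probability T R)
    (coin : V -> T -> bool) (coinP : independent_coins P p coin)
    (w : T) (cf : config R V) :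
  reachable e k t delta c (fun v => coin v w) cf ->
  ended cf ->
  forall v : V,
    is_head cf v \/ (is_non_head cf v /\ exists u : V, belongs cf v u).
Proof.
move=> /sound_reachable [_ nodes] cf_end v.
have [started timer_off _] := cf_end v.
have [tabH /allP sentH joined] := nodes v.
case statusE: (node_status (state cf v)) => //; [by left | right; split=> //].
(* As [ended] says that the timer is off, some join request was sent; the witness is the target of
   the first one. *)
case sentE: (jreq_sent (state cf v)) (joined statusE timer_off) => [//|u l] _.
have u_sent : u \in jreq_sent (state cf v) by rewrite sentE mem_head.
have u_known := sentH _ u_sent.
exists u; split=> //; apply/headbP.
by move: tabH; rewrite -(all_map _ (heads cf)) => /allP/(_ u u_known).
Qed.
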